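(* Let $m,n\in\mathbb{N}$, $m\geq 1$, and let $P\subseteq\mathbb{R}^m$ be such that: (i) There is a hyperplane $H\subseteq\mathbb{R}^m$ of co-dimension $1$ such that $P_1:=P\cap H$ satisfies $\#P_1=N(m-1,n)$ and is generic with respect to $H$, i.e., upon identifying $H\cong\mathbb{R}^{m-1}$ the Vandermonde matrix $V_{m-1,n}(P_1)$ is regular. (ii) The set $P_2:=P\setminus H$ satisfies $\#P_2=N(m,n-1)$ and is generic with respect to the parameters $(m,n-1)$, i.e., the Vandermonde matrix $V_{m,n-1}(P_2)$ is regular. Then $P$ is a generic set with respect to $m,n$, i.e., the Vandermonde matrix $V_{m,n}(P)$ is regular.
   Context: $N(m,n):=\binom{m+n}{m}$ is the number of monomials of degree at most $n$ in $m$ variables. For a set $P=\{p_1,\dots,p_{N(m,n)}\}\subseteq\mathbb{R}^m$ of $N(m,n)$ points, the multivariate Vandermonde matrix $V_{m,n}(P)\in\mathbb{R}^{N(m,n)\times N(m,n)}$ is the matrix whose $i$-th row consists of the values at $p_i$ of all monomials $x_1^{i_1}\cdots x_m^{i_m}$ with $i_1+\dots+i_m\leq n$ (in a fixed order). $P$ is called generic with respect to $m,n$ if $V_{m,n}(P)$ is regular (invertible). Hyperplanes are affine (not necessarily through the origin), and the identification $H\cong\mathbb{R}^{m-1}$ is by an affine isomorphism. *)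

(* Defs.v *)
From HB Require Import structures.
From mathcomp Require Import all_boot all_order all_algebra.
From mathcomp Require Import mpoly.
From mathcomp Require Import classical_sets functions cardinality reals.

Set Implicit Arguments.
Unset Strict Implicit.
Unset Printing Implicit Defensive.

Import GRing.Theory.
Local Open Scope classical_set_scope.
Local Open Scope ring_scope.

(* The degree bound n is an integer because the degree n - 1 is needed for
   n = 0: there are no monomials of negative degree (and, for m >= 1, the
   binomial coefficient 'C(m - 1, m) is indeed 0). *)
Definition N (m : nat) (n : int) : nat :=
  if n is Posz k then 'C(m + k, m) else 0%N.

Definition monomials (m : nat) (n : int) : seq 'X_{1..m} :=
  if n is Posz k then [seq val a | a <- enum {: 'X_{1..m < k.+1}}] else [::].

Lemma mem_monomials m n (a : 'X_{1..m}) :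
  (a \in monomials m n) = ((mdeg a)%:Z <= n).
Proof.
case: n => [k|k] //=; rewrite lez_nat -ltnS.
apply/mapP/idP => [[b _ ->]|lt_ak]; first exact: bmdeg.
by exists (BMultinom lt_ak); rewrite ?mem_enum.
Qed.

Lemma uniq_monomials m n : uniq (monomials m n).
Proof.
by case: n => [k|k] //=; rewrite (map_inj_uniq val_inj) enum_uniq.
Qed.

Lemma size_monomials m n : size (monomials m n) = N m n.
Proof.
case: n => [k|k] //=; rewrite size_map -cardE -card_partial_ord_partitions.
pose f (a : 'X_{1..m < k.+1}) : m.-tuple 'I_k.+1 :=
  [tuple inord (bmnm a i) | i < m].
have lt_f (a : 'X_{1..m < k.+1}) i : (bmnm a i < k.+1)%N.
  by apply: leq_ltn_trans (bmdeg a); rewrite mdegE (bigD1 i) //= leq_addr.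
have fE a i : tnth (f a) i = bmnm a i :> nat.
  by rewrite tnth_mktuple inordK.
have f_inj : injective f.
  by move=> a b eq_f; apply/val_inj/mnmP => i; rewrite -!fE eq_f.
rewrite -(card_imset _ f_inj); apply: eq_card => t.
rewrite [in RHS]finset.inE.
apply/imsetP/idP => [[a _ ->]|le_tk].
  rewrite -ltnS big_tuple (eq_bigr _ (fun i _ => fE a i)) -mdegE.
  exact: bmdeg.
have lt_tk : (mdeg [multinom (tnth t i : nat) | i < m] < k.+1)%N.
  rewrite mdegE ltnS; move: le_tk; rewrite big_tuple.
  by under [X in _ -> (X <= _)%N]eq_bigr do rewrite mnmE.
exists (BMultinom lt_tk) => //; apply: eq_from_tnth => i.
by apply/val_inj; rewrite /= fE mnmE.
Qed.

Definition vandermonde (R : comNzRingType) (m : nat) (n : int)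
    (p : 'I_(N m n) -> 'rV[R]_m) : 'M[R]_(N m n) :=
  \matrix_(i < N m n, j < N m n)
    ('X_[nth 0%MM (monomials m n) j] : {mpoly R[m]}).@[fun k => p i 0 k].

(* Regularity does not depend on the enumeration p of P, as reordering the
   points permutes the rows. *)
Definition generic (R : realType) (m : nat) (n : int) (P : set 'rV[R]_m) :=
  exists p : 'I_(N m n) -> 'rV[R]_m,
    [/\ injective p, range p = P & vandermonde p \in unitmx].

Definition is_hyperplane (R : realType) (m : nat) (H : set 'rV[R]_m) :=
  exists (U : {vspace 'rV[R]_m}) (b : 'rV[R]_m),
    (\dim U).+1 = m /\ H = [set x | x - b \in U].

Definition affine_map (R : realType) (k m : nat) (f : 'rV[R]_k -> 'rV[R]_m) :=
  exists (A : 'M[R]_(k, m)) (b : 'rV[R]_m), forall y, f y = y *m A + b.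

(* f : R^(m-1) -> H is the affine identification; two such identifications
   differ by an affine automorphism of R^(m-1), which preserves genericity. *)
Definition generic_in (R : realType) (m : nat) (n : int)
    (H Q : set 'rV[R]_m) :=
  exists f : 'rV[R]_m.-1 -> 'rV[R]_m,
    [/\ affine_map f, set_bij [set: 'rV[R]_m.-1] H f
      & generic n (f @^-1` Q)].

(* Main.v *)
(** The Vandermonde matrix is regular iff no nonzero polynomial of degree at most
    n vanishes on the points. Let q of degree at most n vanish on P. By
    genericity of P_1, the restriction of q to H is zero, so that q is divisible
    by an equation l of H: the affine projection t of R^m onto H satisfies
    x - t(x) = l(x) v for a fixed vector v, and q = q - q(t) is a multiple of l.
    The quotient has degree at most n - 1 and vanishes on P_2, as l has no zero
    outside H, hence it is zero by genericity of P_2. *)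

Require Import Defs.
From mathcomp Require Import all_boot all_order all_algebra.
From mathcomp Require Import mpoly.
From mathcomp Require Import classical_sets functions cardinality reals.
Local Open Scope classical_set_scope.
Local Open Scope card_scope.
Local Open Scope ring_scope.

Set Implicit Arguments.
Unset Strict Implicit.
Unset Printing Implicit Defensive.

Import GRing.Theory Num.Theory.

Lemma mnm_ind (m : nat) (Q : 'X_{1..m} -> Prop) :
  Q 0%MM -> (forall i a, Q a -> Q (U_(i) + a)%MM) -> forall a, Q a.
Proof.
move=> Q0 QS a; have [d] := ubnP (mdeg a).
elim: d a => // d IHd a lt_ad.
have [->//|a_neq0] := eqVneq a 0%MM.
have [i ai_neq0] : exists i, a i != 0%N.
  apply/existsP; apply: contraNT a_neq0 => /existsPn a0.
  by apply/eqP/mnmP => i; rewrite mnm0E; apply/eqP/negPn.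
have le_Ua : (U_(i) <= a)%MM by rewrite lep1mP.
rewrite -(submK le_Ua) addmC; apply/QS/IHd.
by move: lt_ad; rewrite -{1}(submK le_Ua) mdegD mdeg1 addn1.
Qed.

(** [msize] is the degree plus one, and 0 for the zero polynomial, so only one of the two bounds
    carries a successor; for [d = 0] the bound forces [p = 0]. *)
Lemma msizeM_leq (R : idomainType) (m d e : nat) (p q : {mpoly R[m]}) :
  (msize p <= d)%N -> (msize q <= e.+1)%N -> (msize (p * q) <= d + e)%N.
Proof.
have [->|p_neq0] := eqVneq p 0; first by rewrite mul0r msize0.
have [->|q_neq0] := eqVneq q 0; first by rewrite mulr0 msize0.
move=> le_pd le_qe; rewrite msizeM //.
have := leq_add le_pd le_qe; rewrite addnS.
by case: (_ + _)%N.
Qed.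

Lemma msizeD_leq (R : nzRingType) (m d : nat) (p q : {mpoly R[m]}) :
  (msize p <= d)%N -> (msize q <= d)%N -> (msize (p + q) <= d)%N.
Proof.
by move=> le_pd le_qd; rewrite (leq_trans (msizeD_le _ _)) // geq_max le_pd.
Qed.

Lemma msize_leqP (R : nzRingType) (m d : nat) (q : {mpoly R[m]}) :
  reflect (forall a, a \in msupp q -> (mdeg a < d)%N) (msize q <= d)%N.
Proof.
rewrite msizeE; apply: (iffP (bigmax_leqP_seq _ _ _ _)) => le_d a qa.
  exact: le_d.
by move=> _; apply: le_d.
Qed.

Lemma comp_mpolyMX (R : comNzRingType) (m k : nat) (t : m.-tuple {mpoly R[k]})
    (i : 'I_m) (a : 'X_{1..m}) :
  'X_[U_(i) + a] \mPo t = tnth t i * ('X_[a] \mPo t).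
Proof. by rewrite mpolyXD rmorphM /= comp_mpolyXU -tnth_nth. Qed.

Lemma msize_comp_mpoly (R : idomainType) (m k : nat)
    (t : m.-tuple {mpoly R[k]}) (q : {mpoly R[m]}) :
  (forall i, msize (tnth t i) <= 2)%N -> (msize (q \mPo t) <= msize q)%N.
Proof.
move=> t_le2.
have XP a : (msize ('X_[R, a] \mPo t) <= (mdeg a).+1)%N.
  elim/mnm_ind: a => [|i a IHa]; first by rewrite mpolyX0 comp_mpoly1 msize1.
  rewrite comp_mpolyMX mdegD mdeg1 -[(1 + _).+1%N]/(2 + _)%N.
  exact: msizeM_leq.
rewrite comp_mpolyEX big_seq; apply: (leq_trans (msize_sum _ _ _)).
apply/bigmax_leqP_seq => a _ qa.
rewrite (leq_trans (msizeZ_le _ _)) // (leq_trans (XP a)) //.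
exact: msize_mdeg_lt.
Qed.

Lemma comp_mpolyA (R : comNzRingType) (m k l : nat)
    (t : m.-tuple {mpoly R[k]}) (u : k.-tuple {mpoly R[l]}) (q : {mpoly R[m]}) :
  (q \mPo t) \mPo u = q \mPo [tuple tnth t i \mPo u | i < m].
Proof.
rewrite (comp_mpolyE q t) (comp_mpolyE q) raddf_sum /=; apply: eq_bigr => a _.
rewrite comp_mpolyZ rmorph_prod /=; congr (_ *: _); apply: eq_bigr => i _.
by rewrite rmorphXn /= tnth_mktuple.
Qed.

(** * Affine maps as tuples of polynomials, and division by an affine equation *)

(** The map y -> y A + b in coordinates: composing a polynomial with this tuple restricts it to the
    image of the map. *)
Definition affine_mpolys (R : nzRingType) (k m : nat) (A : 'M[R]_(k, m))
    (b : 'rV[R]_m) : m.-tuple {mpoly R[k]} :=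
  [tuple \sum_j A j i *: 'X_j + (b 0 i)%:MP | i < m].

Lemma meval_affine_mpolys (R : comNzRingType) (k m : nat) (A : 'M[R]_(k, m))
    (b : 'rV[R]_m) (y : 'rV[R]_k) i :
  (tnth (affine_mpolys A b) i).@[fun j => y 0 j] = (y *m A + b) 0 i.
Proof.
rewrite tnth_mktuple mevalD mevalC raddf_sum !mxE /=; congr (_ + _).
by apply: eq_bigr => j _; rewrite mevalZ mevalXU mulrC.
Qed.

Lemma msize_affine_mpolys (R : nzRingType) (k m : nat) (A : 'M[R]_(k, m))
    (b : 'rV[R]_m) i : (msize (tnth (affine_mpolys A b) i) <= 2)%N.
Proof.
rewrite tnth_mktuple msizeD_leq //; last by rewrite msizeC; case: eqP.
apply: (leq_trans (msize_sum _ _ _)); apply/bigmax_leqP => j _.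
by rewrite (leq_trans (msizeZ_le _ _)) // msizeX mdeg1.
Qed.

Lemma comp_affine_mpolys (R : comNzRingType) (k m l : nat) (A : 'M[R]_(k, m))
    (b : 'rV[R]_m) (B : 'M[R]_(l, k)) (c : 'rV[R]_k) i :
  tnth (affine_mpolys A b) i \mPo affine_mpolys B c
    = tnth (affine_mpolys (B *m A) (c *m A + b)) i.
Proof.
rewrite !tnth_mktuple comp_mpolyD comp_mpolyC !mxE mpolyCD addrA.
congr (_ + _); rewrite [in LHS]raddf_sum [in RHS]raddf_sum /=.
under eq_bigr => j _ do rewrite comp_mpolyZ comp_mpolyXU -tnth_nth
  tnth_mktuple scalerDr scaler_sumr.
rewrite big_split exchange_big /=; congr (_ + _); apply: eq_bigr => j _.
  rewrite mxE scaler_suml; apply: eq_bigr => h _.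
  by rewrite scalerA mulrC.
by rewrite -mul_mpolyC -mpolyCM mulrC.
Qed.

(* Telescoping: if each [X_i - t_i] is a multiple of [l], then so is
   [q - q(t)], and the degree drops by one in the quotient. *)
Lemma sub_comp_mpoly_factor (R : idomainType) (m : nat)
    (t : m.-tuple {mpoly R[m]}) (l : {mpoly R[m]}) (v : 'I_m -> R)
    (q : {mpoly R[m]}) (d : nat) :
  (forall i, msize (tnth t i) <= 2)%N ->
  (forall i, 'X_i - tnth t i = v i *: l) -> (msize q <= d.+1)%N ->
  exists2 r, q - (q \mPo t) = l * r & (msize r <= d)%N.
Proof.
move=> t_le2 tE /msize_leqP le_qd.
have XP a : exists2 r, 'X_[R, a] - ('X_[a] \mPo t) = l * r
    & (msize r <= mdeg a)%N.
  elim/mnm_ind: a => [|i a [r ar le_ra]].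
    by exists 0; rewrite ?msize0 // mpolyX0 comp_mpoly1 subrr mulr0.
  (* With t^a the image of x^a, this quotient comes from x_i x^a - t_i t^a = (x_i - t_i) x^a + t_i
     (x^a - t^a). *)
  exists (v i *: 'X_[a] + r * tnth t i).
    rewrite comp_mpolyMX mpolyXD mulrDr mulrA -ar -scalerAr scalerAl -tE.
    by rewrite [_ * tnth t i]mulrC mulrBl mulrBr addrA subrK.
  rewrite mdegD mdeg1 add1n msizeD_leq //.
    by rewrite (leq_trans (msizeZ_le _ _)) // msizeX.
  by rewrite -addn1 msizeM_leq.
rewrite comp_mpolyEX {1}[q]mpolyE -sumrB big_seq.
elim/big_ind: _ => [|_ _ [r1 -> le1] [r2 -> le2]|a qa].
- by exists 0; rewrite ?mulr0 ?msize0.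
- by exists (r1 + r2); rewrite ?mulrDr ?msizeD_leq.
have [r ar le_r] := XP a; exists (q@_a *: r).
  by rewrite -scalerBr ar scalerAr.
by rewrite (leq_trans (msizeZ_le _ _)) // (leq_trans le_r) // -ltnS le_qd.
Qed.

Lemma mxrank_le1P (F : fieldType) (k m : nat) (M : 'M[F]_(k, m)) :
  (\rank M <= 1)%N -> exists (u : 'cV[F]_k) (v : 'rV[F]_m), M = u *m v.
Proof.
move=> rk_M; exists (col_ebase M *m pid_mx (\rank M)).
exists (pid_mx (\rank M) *m row_ebase M).
rewrite mulmxA -(mulmxA (col_ebase M)) mul_pid_mx minnn (minn_idPr rk_M).
by rewrite mulmx_ebase.
Qed.

(** * Regular Vandermonde matrices and vanishing polynomials *)

(** The matrix sends the coefficient vector of a polynomial to its values at the points, so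
    regularity means a trivial kernel. Bounding the support rather than [msize] also covers negative
    [n], where only 0 qualifies. *)
Lemma vandermonde_unitP (F : fieldType) (m : nat) (n : int)
    (p : 'I_(N m n) -> 'rV[F]_m) :
  vandermonde p \in unitmx <->
  forall q : {mpoly F[m]},
    (forall a, a \in msupp q -> (mdeg a)%:Z <= n) ->
    (forall i, q.@[fun k => p i 0 k] = 0) -> q = 0.
Proof.
have sumE (E : 'X_{1..m} -> {mpoly F[m]}) :
    \sum_(a <- monomials m n) E a
      = \sum_(j < N m n) E (nth 0%MM (monomials m n) j).
  by rewrite (big_nth 0%MM) size_monomials big_mkord.
split=> [V_unit q le_qn q_eq0|V_inj].
  have qE : q = \sum_(a <- monomials m n) q@_a *: 'X_[a].
    apply/mpolyP => a; rewrite raddf_sum /=.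
    under eq_bigr => b _ do rewrite mcoeffZ mcoeffX.
    have [le_an|gt_an] := boolP (a \in monomials m n).
      rewrite (bigD1_seq a) ?uniq_monomials //= eqxx mulr1 big1 ?addr0 //.
      by move=> b /negPf ->; rewrite mulr0.
    rewrite big_seq big1 => [|b le_bn].
      apply/memN_msupp_eq0; apply: contra gt_an => /le_qn.
      by rewrite mem_monomials.
    by case: eqP => [ab|_]; rewrite ?mulr0 // -ab le_bn in gt_an *.
  pose c := \col_(j < N m n) q@_(nth 0%MM (monomials m n) j).
  have Vc : vandermonde p *m c = 0.
    apply/matrixP => i z; rewrite [RHS]mxE -(q_eq0 i) qE sumE raddf_sum mxE /=.
    by apply: eq_bigr => j _; rewrite !mxE mevalZ mulrC.
  have c0 : c = 0 by rewrite -(mulKmx V_unit c) Vc mulmx0.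
  rewrite qE sumE big1 // => j _.
  by move/matrixP/(_ j 0): c0; rewrite !mxE => ->; rewrite scale0r.
(* A row vector killed by the transposed matrix is a coefficient vector in the kernel of the
   matrix. *)
rewrite -unitmx_tr -row_free_unit; apply: inj_row_free => v vV.
pose q := \sum_(j < N m n) v 0 j *: 'X_[F, nth 0%MM (monomials m n) j].
have coefq (j : 'I_(N m n)) : q@_(nth 0%MM (monomials m n) j) = v 0 j.
  rewrite raddf_sum (bigD1 j) //= mcoeffZ mcoeffX eqxx mulr1 big1 ?addr0 //.
  move=> h /negPf neq_hj; rewrite mcoeffZ mcoeffX nth_uniq ?size_monomials //.
    by rewrite (inj_eq val_inj) neq_hj mulr0.
  exact: uniq_monomials.
suff q0 : q = 0 by apply/rowP => j; rewrite -coefq q0 mcoeff0 mxE.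
apply: V_inj => [a|i].
  move/msupp_sum_le => /flatten_mapP[j _ /msuppZ_le].
  rewrite msuppX inE => /eqP ->.
  by rewrite -mem_monomials mem_nth // size_monomials.
rewrite raddf_sum /=; move/rowP/(_ i): vV; rewrite !mxE => vVi.
by rewrite -[RHS]vVi; apply: eq_bigr => j _; rewrite mevalZ !mxE.
Qed.

(** Pascal's rule: the sizes of P_1 and P_2 add up to that of P. For [n = 0] the last term is 0 and
    P_2 is empty. *)
Lemma N_pascal (m n : nat) :
  N m.+1 n%:Z = (N m n%:Z + N m.+1 (n%:Z - 1))%N.
Proof.
case: n => [|n]; first by rewrite /= !addn0 !binn.
by rewrite -predn_int // /= addnS binS addSnnS addnC.
Qed.

(** With B a right inverse of A, t(x) = (x - b) B A + b is an affine projection onto the hyperplane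
    parametrized by A and b. The matrix 1 - B A has rank at most 1, hence equals u v, so x - t(x) =
    l(x) v with l(x) = (x - b) u. Moreover q(t) = 0, since t factors through the parametrization. *)
Lemma hyperplane_factor (F : fieldType) (m d : nat) (A : 'M[F]_(m, m.+1))
    (b : 'rV[F]_m.+1) (q : {mpoly F[m.+1]}) :
  row_free A -> (msize q <= d.+1)%N -> q \mPo affine_mpolys A b = 0 ->
  exists l r, [/\ q = l * r, (msize r <= d)%N
    & forall x : 'rV_m.+1, l.@[fun k => x 0 k] = 0 ->
        exists y, x = y *m A + b].
Proof.
move=> A_free le_qd q_eq0; have [B AB1] := row_freeP A_free.
pose g := affine_mpolys B (- b *m B).
pose t := [tuple tnth (affine_mpolys A b) i \mPo g | i < m.+1].
have [u [v uvE]] : exists (u : 'cV_m.+1) (v : 'rV_m.+1), 1%:M - B *m A = u *m v.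
  apply: mxrank_le1P; have : (A <= kermx (1%:M - B *m A))%MS.
    by apply/sub_kermxP; rewrite mulmxBr mulmx1 mulmxA AB1 mul1mx subrr.
  (* Rank-nullity: the kernel of 1 - B A contains the m independent rows of A. *)
  move/mxrankS; rewrite mxrank_ker (eqP A_free).
  by rewrite leq_subRL ?rank_leq_row // -(leq_add2r m _ 1).
pose l := tnth (affine_mpolys u (- b *m u)) 0.
have lE (x : 'rV_m.+1) : l.@[fun k => x 0 k] = ((x - b) *m u) 0 0.
  by rewrite meval_affine_mpolys mulmxBl mulNmx.
have tE i : 'X_i - tnth t i = v 0 i *: l.
  rewrite tnth_mktuple comp_affine_mpolys.
  have -> : 'X_i = tnth (affine_mpolys (1%:M : 'M[F]_m.+1) 0) i.
    rewrite tnth_mktuple mxE addr0 (bigD1 i) //= mxE eqxx scale1r.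
    rewrite big1 ?addr0 // => j /negPf neq_ji.
    by rewrite mxE neq_ji scale0r.
  have -> : - b *m B *m A + b = b *m u *m v.
    by rewrite -[RHS]mulmxA -uvE mulmxBr mulmx1 mulmxA !mulNmx addrC.
  rewrite /l !tnth_mktuple opprD addrACA -sumrB mxE sub0r scalerDr scaler_sumr.
  congr (_ + _).
    apply: eq_bigr => j _; rewrite scalerA -scalerBl; congr (_ *: _).
    move/matrixP/(_ j i): uvE; rewrite !mxE big_ord1 => ->.
    by rewrite mulrC.
  rewrite mulNmx !mxE !big_ord1 -mul_mpolyC -!mpolyCN -mpolyCM.
  by rewrite mulrN mulrC mxE.
have t_le2 i : (msize (tnth t i) <= 2)%N.
  by rewrite tnth_mktuple comp_affine_mpolys msize_affine_mpolys.
have [r qE le_rd] := sub_comp_mpoly_factor t_le2 tE le_qd.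
exists l, r; split=> // [|x].
  by rewrite -qE -comp_mpolyA q_eq0 comp_mpoly0 subr0.
(* If l(x) = 0 then x = t(x), so x has parameter (x - b) B. *)
rewrite lE => xu0; exists ((x - b) *m B).
have xu : (x - b) *m u = 0 by apply/matrixP => i j; rewrite !ord1 xu0 mxE.
rewrite -mulmxA -[B *m A](subKr 1%:M) uvE mulmxBr mulmx1 mulmxA xu.
by rewrite mul0mx subr0 subrK.
Qed.

(** The shift by one matches [msize], and lets [d = 0] stand for the degree bound -1. *)
Lemma generic_vanish (R : realType) (m d : nat) (P : set 'rV[R]_m)
    (q : {mpoly R[m]}) :
  generic (d%:Z - 1) P -> (msize q <= d)%N ->
  (forall x : 'rV_m, P x -> q.@[fun k => x 0 k] = 0) -> q = 0.
Proof.
move=> [p [_ pP /vandermonde_unitP p_unit]] /msize_leqP le_qd q_eq0.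
apply: p_unit => [a /le_qd lt_ad|i]; first by rewrite lerBrDr lez_nat addn1.
by apply: q_eq0; rewrite -pP; exists i.
Qed.

Theorem theorem7p1 (R : realType) (m n : nat) (P : set 'rV[R]_m)
    (m_ge1 : (1 <= m)%N)
    (P_split : exists H : set 'rV[R]_m,
      [/\ is_hyperplane H,
          P `&` H #= `I_(N m.-1 n%:Z) /\ generic_in n%:Z H (P `&` H)
        & P `\` H #= `I_(N m (n%:Z - 1)) /\ generic (n%:Z - 1) (P `\` H)]) :
  generic n%:Z P.
Proof.
case: m m_ge1 P P_split => // m _ P /= [H [_ [_ genH] [_ gen2]]].
case: genH => f [[A [b fE]] [f_maps f_inj f_surj] gen1].
have {}f_inj : injective f by move=> y z; apply: f_inj; rewrite in_setT.
have A_free : row_free A.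
  apply: inj_row_free => y yA0; apply: f_inj.
  by rewrite !fE yA0 mul0mx.
have [p1 [p1_inj p1P _]] := gen1; have [p2 [p2_inj p2P _]] := gen2.
have p1PH i : (P `&` H) (f (p1 i)).
  by suff: (f @^-1` (P `&` H)) (p1 i) by []; rewrite -p1P; exists i.
have p2PH i : (P `\` H) (p2 i) by rewrite -p2P; exists i.
have e := N_pascal m n.
(* The enumeration of P lists P_1, carried into H by [f], and then P_2. *)
pose p i := match fintype.split (cast_ord e i) with
            | inl j => f (p1 j) | inr j => p2 j
            end.
have pl j : p (cast_ord (esym e) (lshift _ j)) = f (p1 j).
  by rewrite /p cast_ordKV (unsplitK (inl j)).
have pr j : p (cast_ord (esym e) (rshift _ j)) = p2 j.
  by rewrite /p cast_ordKV (unsplitK (inr j)).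
have p_inj : injective p.
  move=> i j; rewrite /p => pij.
  apply: (@cast_ord_inj _ _ e).
  rewrite -(splitK (cast_ord _ i)) -(splitK (cast_ord _ j)); congr unsplit.
  (* In the two mixed cases a single point would lie both in H and outside it. *)
  move: pij; case: fintype.split => i'; case: fintype.split => j' pij.
  - by congr inl; apply/p1_inj/f_inj.
  - by case: (p2PH j') => _ []; rewrite -pij; have [] := p1PH i'.
  - by case: (p2PH i') => _ []; rewrite pij; have [] := p1PH j'.
  - by congr inr; apply: p2_inj.
have pP : range p = P.
  apply/seteqP; split=> [_ [i _ <-]|x Px].
    rewrite /p; case: fintype.split => j; first by have [] := p1PH j.
    by have [] := p2PH j.
  have [Hx|nHx] := boolp.pselect (H x).
    have [y _ yx] := f_surj x Hx.
    have : (f @^-1` (P `&` H)) y by rewrite /preimage /= yx.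
    rewrite -p1P => -[j _ jy]; exists (cast_ord (esym e) (lshift _ j)) => //.
    by rewrite pl jy yx.
  have : (P `\` H) x by [].
  rewrite -p2P => -[j _ jx]; exists (cast_ord (esym e) (rshift _ j)) => //.
  by rewrite pr.
exists p; split=> //; apply/vandermonde_unitP => q le_qn q_eq0.
have le_q : (msize q <= n.+1)%N.
  by apply/msize_leqP => a /le_qn; rewrite lez_nat.
have qP x : P x -> q.@[fun k => x 0 k] = 0.
  by rewrite -pP => -[i _ <-].
have qf_eq0 : q \mPo affine_mpolys A b = 0.
  apply: (@generic_vanish _ _ n.+1 (f @^-1` (P `&` H))).
  - by have -> : n.+1%:Z - 1 = n%:Z by rewrite -addn1 PoszD addrK.
  - rewrite (leq_trans (msize_comp_mpoly _ _)) // => i.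
    exact: msize_affine_mpolys.
  (* The restricted polynomial takes at y the value of q at f(y), a point of P. *)
  move=> y [Py _]; rewrite comp_mpoly_meval -[RHS](qP _ Py) fE.
  by apply: meval_eq => i; rewrite meval_affine_mpolys.
have [l [r [qE le_rn l_eq0]]] := hyperplane_factor A_free le_q qf_eq0.
rewrite qE (generic_vanish gen2 le_rn) ?mulr0 // => x [Px nHx].
(* At a point of P_2 either r vanishes, as wanted, or l does, which puts the point in the image of
   [f], inside H. *)
move: (qP x Px); rewrite qE mevalM => /eqP; rewrite mulf_eq0.
case/orP=> /eqP // /l_eq0[y xE]; case: nHx.
by rewrite xE -fE; apply: f_maps.
Qed.
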